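(* Let $F(\mathbf{X},\mathbf{Y})$ be a Boolean formula with outputs $\mathbf{X}=(x_1,\ldots,x_n)$ and inputs $\mathbf{Y}=(y_1,\ldots,y_m)$, and suppose $F$ is in $\mathsf{SynNNF}$ with respect to the sequence $\mathbf{X}$. Then: (i) for every $i\in\{1,\ldots,n\}$, $$\exists \mathbf{X}_1^i\, F(\mathbf{X},\mathbf{Y}) \;\Leftrightarrow\; \widehat{F}^{\,i+1}[\overline{\mathbf{X}}_{i+1}^n \mapsto \neg\mathbf{X}_{i+1}^n];$$ (ii) a Skolem function vector $\Psi_1^n=(\psi_1(\mathbf{Y}),\ldots,\psi_n(\mathbf{Y}))$ for $\mathbf{X}_1^n$ in $F$ can be computed in $\mathcal{O}(n^2\cdot |F|)$ time and $\mathcal{O}(n\cdot |F|)$ space.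
   Context: A formula is in negation normal form (NNF) if it uses only $\wedge,\vee,\neg$ and negation is applied only to variables. $|F|$ denotes the number of nodes of the (simplified) DAG representation of the NNF formula $F$. For $1\le i\le j\le n$, $\mathbf{X}_i^j=(x_i,\ldots,x_j)$. The positive form $\widehat{F}(\mathbf{X},\overline{\mathbf{X}},\mathbf{Y})$ of an NNF formula $F$ is obtained by replacing every occurrence of $\neg x_i$ ($x_i\in\mathbf{X}$) by a fresh variable $\overline{x}_i$. For $b,c\in\{0,1\}$, $\widehat{F}(\mathbf{b}^i,\mathbf{X}_{i+1}^n,\mathbf{c}^i,\overline{\mathbf{X}}_{i+1}^n,\mathbf{Y})$ denotes $\widehat{F}$ with $x_1,\ldots,x_i$ set to $b$ and $\overline{x}_1,\ldots,\overline{x}_i$ set to $c$. The $i$-th reduct is $\widehat{F}^{\,i}=\widehat{F}(1^{i-1},\mathbf{X}_i^n,1^{i-1},\overline{\mathbf{X}}_i^n,\mathbf{Y})$ for $i\in\{1,\ldots,n\}$, and $\widehat{F}^{\,n+1}=\widehat{F}(1^n,1^n,\mathbf{Y})$. For $j,k\in\{0,1\}$ let $\alpha_i^{jk}=\widehat{F}^{\,i}[x_i\mapsto j,\overline{x}_i\mapsto k,\overline{\mathbf{X}}_{i+1}^n\mapsto\neg\mathbf{X}_{i+1}^n]$; $\widehat{F}^{\,i}$ is $\wedge_i$-unrealizable if $\alpha_i^{11}\wedge\neg\alpha_i^{10}\wedge\neg\alpha_i^{01}$ is unsatisfiable. $F$ is in $\mathsf{SynNNF}$ w.r.t. $\mathbf{X}$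 if $F$ is in NNF and $\widehat{F}^{\,i}$ is $\wedge_i$-unrealizable for all $1\le i\le n$. A Skolem function vector for $\mathbf{X}$ in $F$ is a tuple of Boolean functions $\Psi=(\psi_1(\mathbf{Y}),\ldots,\psi_n(\mathbf{Y}))$ such that $\forall\mathbf{Y}\,(\exists\mathbf{X}\,F(\mathbf{X},\mathbf{Y})\Leftrightarrow F(\Psi(\mathbf{Y}),\mathbf{Y}))$ holds. *)

(* Defs.v *)
From mathcomp Require Import all_boot.

Set Implicit Arguments.
Unset Strict Implicit.
Unset Printing Implicit Defensive.

(** * Boolean formulas *)

Inductive form (V : Type) : Type :=
  | FConst of bool
  | FVar of V
  | FNot of form V
  | FAnd of form V & form V
  | FOr of form V & form V.

Arguments FConst {V} b.

Fixpoint eval (V : Type) (rho : V -> bool) (f : form V) : bool :=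
  match f with
  | FConst b => b
  | FVar v => rho v
  | FNot g => ~~ eval rho g
  | FAnd g h => eval rho g && eval rho h
  | FOr g h => eval rho g || eval rho h
  end.

Fixpoint subst (V W : Type) (s : V -> form W) (f : form V) : form W :=
  match f with
  | FConst b => FConst b
  | FVar v => s v
  | FNot g => FNot (subst s g)
  | FAnd g h => FAnd (subst s g) (subst s h)
  | FOr g h => FOr (subst s g) (subst s h)
  end.

Definition unsat (V : Type) (f : form V) : Prop :=
  forall rho : V -> bool, eval rho f = false.

Fixpoint is_nnf (V : Type) (f : form V) : bool :=
  match f with
  | FConst _ => true
  | FVar _ => true
  | FNot (FVar _) => true
  | FNot _ => false
  | FAnd g h => is_nnf g && is_nnf h
  | FOr g h => is_nnf g && is_nnf h
  end.

(** * Positive forms, reducts and SynNNF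

    Ordinals are 0-based: [X k] is the variable x_(k+1) of the mathematical
    text.  Natural-number indices [i] (of reducts etc.) are 1-based. *)

Inductive fvar (n m : nat) : Type := X of 'I_n | Y of 'I_m.
Arguments X {n m} k.
Arguments Y {n m} j.

Inductive pvar (n m : nat) : Type := PX of 'I_n | PXbar of 'I_n | PY of 'I_m.
Arguments PX {n m} k.
Arguments PXbar {n m} k.
Arguments PY {n m} j.

Definition asg (n m : nat) (x : 'I_n -> bool) (y : 'I_m -> bool)
    (v : fvar n m) : bool :=
  match v with X k => x k | Y j => y j end.

Definition pos_var (n m : nat) (v : fvar n m) : pvar n m :=
  match v with X k => PX k | Y j => PY j end.

(* Meaningful on formulas in NNF. *)
Fixpoint hat (n m : nat) (f : form (fvar n m)) : form (pvar n m) :=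
  match f with
  | FConst b => FConst b
  | FVar v => FVar (pos_var v)
  | FNot (FVar (X k)) => FVar (PXbar k)
  | FNot g => FNot (hat g)
  | FAnd g h => FAnd (hat g) (hat h)
  | FOr g h => FOr (hat g) (hat h)
  end.

(* The substitution x_1, ..., x_i := b and xbar_1, ..., xbar_i := c. *)
Definition set_prefix (n m : nat) (b c : bool) (i : nat) (v : pvar n m) :
    form (pvar n m) :=
  match v with
  | PX k => if k < i then FConst b else FVar v
  | PXbar k => if k < i then FConst c else FVar v
  | PY _ => FVar v
  end.

Definition reduct (n m : nat) (F : form (fvar n m)) (i : nat) :
    form (pvar n m) :=
  subst (set_prefix true true i.-1) (hat F).

(* The substitution x_i := b, xbar_i := c. *)
Definition set_one (n m : nat) (i : nat) (b c : bool) (v : pvar n m) :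
    form (pvar n m) :=
  match v with
  | PX k => if k.+1 == i then FConst b else FVar v
  | PXbar k => if k.+1 == i then FConst c else FVar v
  | PY _ => FVar v
  end.

(* xbar_k := ~ x_k.  Where it is applied below, the xbar_k that still occur
   are exactly those with k > i, so no index bound is needed. *)
Definition bar_neg (n m : nat) (v : pvar n m) : form (fvar n m) :=
  match v with
  | PX k => FVar (X k)
  | PXbar k => FNot (FVar (X k))
  | PY j => FVar (Y j)
  end.

Definition alpha (n m : nat) (F : form (fvar n m)) (i : nat) (b c : bool) :
    form (fvar n m) :=
  subst (@bar_neg n m) (subst (set_one i b c) (reduct F i)).

Definition and_unrealizable (n m : nat) (F : form (fvar n m)) (i : nat) : Prop :=
  unsat (FAnd (FAnd (alpha F i true true) (FNot (alpha F i true false)))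
              (FNot (alpha F i false true))).

Definition SynNNF (n m : nat) (F : form (fvar n m)) : Prop :=
  is_nnf F /\ forall i, 1 <= i <= n -> and_unrealizable F i.

(* Truth of "exists x_1 ... x_i, F" at the point (x, y); it does not depend on
   the first i components of x. *)
Definition ex_prefix (n m : nat) (F : form (fvar n m)) (i : nat)
    (x : 'I_n -> bool) (y : 'I_m -> bool) : Prop :=
  exists x' : 'I_n -> bool,
    (forall k : 'I_n, i <= k -> x' k = x k) /\ eval (asg x' y) F.

Definition is_skolem (n m : nat) (F : form (fvar n m))
    (psi : 'I_n -> ('I_m -> bool) -> bool) : Prop :=
  forall y : 'I_m -> bool,
    (exists x : 'I_n -> bool, eval (asg x y) F) <->
    eval (asg (fun k => psi k y) y) F.

(** * DAG representations

    A DAG is the list of its nodes in topological order; the arguments of a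
    node are positions of earlier nodes. *)

Inductive gate (V : Type) : Type :=
  | GConst of bool
  | GVar of V
  | GNot of nat
  | GAnd of nat & nat
  | GOr of nat & nat.

Arguments GConst {V} b.
Arguments GNot {V} p.
Arguments GAnd {V} p q.
Arguments GOr {V} p q.

Definition children (V : Type) (g : gate V) : seq nat :=
  match g with
  | GConst _ | GVar _ => [::]
  | GNot p => [:: p]
  | GAnd p q | GOr p q => [:: p; q]
  end.

Definition wf_dag (V : Type) (D : seq (gate V)) : Prop :=
  forall k g, onth D k = Some g -> all (fun p => p < k) (children g).

Definition gate_form (V : Type) (fs : seq (form V)) (g : gate V) : form V :=
  let arg p := nth (FConst false) fs p in
  match g with
  | GConst b => FConst b
  | GVar v => FVar v
  | GNot p => FNot (arg p)
  | GAnd p q => FAnd (arg p) (arg q)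
  | GOr p q => FOr (arg p) (arg q)
  end.

(* The k-th entry is the formula rooted at the k-th node. *)
Definition unfold_dag (V : Type) (D : seq (gate V)) : seq (form V) :=
  foldl (fun fs g => rcons fs (gate_form fs g)) [::] D.

(* The root is the last node. *)
Definition dag_of (V : Type) (F : form V) (D : seq (gate V)) : Prop :=
  wf_dag D /\ onth (unfold_dag D) (size D).-1 = Some F.

(** * Word RAM

    Unit-cost RAM with registers and a memory of finitely many cells.
    A program mentions only finitely many registers, so the space is the number
    of memory cells (input and output included).  All words are smaller than
    [W]; an overflow, an access outside the memory and a jump outside the
    program are faults ([None]). *)

Inductive instr : Type :=
  | IConst (r v : nat)       (* r := v *)
  | IMove (r a : nat)        (* r := a *)
  | IAdd (r a b : nat)       (* r := a + b *)
  | ISub (r a b : nat)       (* r := a - b, truncated at 0 *)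
  | ILoad (r a : nat)        (* r := mem[a] *)
  | IStore (a b : nat)       (* mem[a] := b *)
  | IJump (l : nat)
  | IJumpZ (a l : nat)       (* jump to l if a = 0 *)
  | IHalt.

Record config : Type := Config { pc : nat; regs : nat -> nat; mem : seq nat }.

Definition set_reg (W : nat) (c : config) (r v : nat) : option config :=
  if v < W then
    Some (Config (pc c).+1 (fun k => if k == r then v else regs c k) (mem c))
  else None.

Definition step (P : seq instr) (W : nat) (c : config) : option config :=
  match onth P (pc c) with
  | None | Some IHalt => None
  | Some (IConst r v) => set_reg W c r v
  | Some (IMove r a) => set_reg W c r (regs c a)
  | Some (IAdd r a b) => set_reg W c r (regs c a + regs c b)
  | Some (ISub r a b) => set_reg W c r (regs c a - regs c b)
  | Some (ILoad r a) => obind (set_reg W c r) (onth (mem c) (regs c a))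
  | Some (IStore a b) =>
      if regs c a < size (mem c) then
        Some (Config (pc c).+1 (regs c) (set_nth 0 (mem c) (regs c a) (regs c b)))
      else None
  | Some (IJump l) => Some (Config l (regs c) (mem c))
  | Some (IJumpZ a l) =>
      Some (Config (if regs c a == 0 then l else (pc c).+1) (regs c) (mem c))
  end.

Fixpoint run (P : seq instr) (W k : nat) (c : config) : option config :=
  if k is k'.+1 then obind (run P W k') (step P W c) else Some c.

Definition init_config (inp : seq nat) (s : nat) : config :=
  Config 0 (fun=> 0) (inp ++ nseq (s - size inp) 0).

(* On input [inp], with words smaller than [W], [P] halts after at most [t]
   steps in [s] memory cells, in a configuration satisfying [post]. *)
Definition computes (P : seq instr) (W t s : nat) (inp : seq nat)
    (post : config -> Prop) : Prop :=
  [/\ size inp <= s, all (fun w => w < W) inp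
    & exists k c, [/\ k <= t, run P W k (init_config inp s) = Some c,
                      onth P (pc c) = Some IHalt & post c]].

(** * Input and output formats *)

(* Every node takes three words; [ev] encodes a variable by two words. *)
Definition enc_gate (V : Type) (ev : V -> seq nat) (g : gate V) : seq nat :=
  match g with
  | GConst b => [:: 0; nat_of_bool b; 0]
  | GVar v => 1 :: ev v
  | GNot p => [:: 2; p; 0]
  | GAnd p q => [:: 3; p; q]
  | GOr p q => [:: 4; p; q]
  end.

Definition enc_dag (V : Type) (ev : V -> seq nat) (D : seq (gate V)) : seq nat :=
  flatten (map (enc_gate ev) D).

Definition enc_input_var (m : nat) (j : 'I_m) : seq nat := [:: 1; nat_of_ord j].

Definition enc_fvar (n m : nat) (v : fvar n m) : seq nat :=
  match v with X k => [:: 0; nat_of_ord k] | Y j => enc_input_var j end.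

Definition enc_problem (n m : nat) (D : seq (gate (fvar n m))) : seq nat :=
  [:: n; m; size D] ++ enc_dag (@enc_fvar n m) D.

Definition slice (b l : nat) (s : seq nat) : seq nat := take l (drop b s).

(* The memory holds a DAG [C] over the inputs, stored at address [regs 0] with
   [regs 1] nodes, and, at address [regs 2], the positions [outs] of the [n]
   output nodes. *)
Definition outputs_dag (n m : nat) (c : config) (C : seq (gate 'I_m))
    (outs : seq nat) : Prop :=
  [/\ size C = regs c 1,
      slice (regs c 0) (3 * size C) (mem c) = enc_dag (@enc_input_var m) C,
      size outs = n
    & slice (regs c 2) n (mem c) = outs].

(* The function of the inputs computed at output k. *)
Definition dag_fun (n m : nat) (C : seq (gate 'I_m)) (outs : seq nat)
    (k : 'I_n) (y : 'I_m -> bool) : bool :=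
  eval y (nth (FConst false) (unfold_dag C) (nth 0 outs k)).

Definition outputs_skolem (n m : nat) (F : form (fvar n m)) (c : config) : Prop :=
  exists (C : seq (gate 'I_m)) (outs : seq nat),
    [/\ outputs_dag n c C outs, wf_dag C,
        all (fun p => p < size C) outs
      & is_skolem F (dag_fun C outs)].

(* Main.v *)
Require Import Defs.
From mathcomp Require Import all_boot zify.

Set Implicit Arguments.
Unset Strict Implicit.
Unset Printing Implicit Defensive.

(* The positive form of an NNF formula is monotone in the x_k and xbar_k, so
   exists x_i, F^i implies F^(i+1) (all with xbar_k := ~ x_k for the later k);
   and_i-unrealizability is exactly the converse: if alpha_i^11 holds then so
   does alpha_i^10 (take x_i = 1) or alpha_i^01 (take x_i = 0).  Iterating
   gives (i), and shows that psi_i := alpha_i^10, with psi_(i+1), ..., psi_n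
   substituted for the later variables, is a Skolem function vector.

   For (ii), emit one copy of the DAG of F for each i = n, ..., 1, whose root
   computes psi_i: a leaf x_k or ~ x_k becomes a constant when k <= i, and
   reads the root of the k-th copy when k > i.  One gate is emitted per input
   gate, so n |F| gates are written in constant time each. *)

(** * Existential quantification in SynNNF *)

Lemma eq_eval (V : Type) (rho rho' : V -> bool) (f : form V) :
  rho =1 rho' -> eval rho f = eval rho' f.
Proof. by move=> e; elim: f => //= [g -> | g -> h -> | g -> h ->]. Qed.

Lemma eval_subst (V W : Type) (rho : W -> bool) (s : V -> form W) (f : form V) :
  eval rho (subst s f) = eval (fun v => eval rho (s v)) f.
Proof. by elim: f => //= [g -> | g -> h -> | g -> h ->]. Qed.

Definition pasg (n m : nat) (a b : 'I_n -> bool) (y : 'I_m -> bool)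
    (v : pvar n m) : bool :=
  match v with PX k => a k | PXbar k => b k | PY j => y j end.

Definition evalhat (n m : nat) (F : form (fvar n m)) (a b : 'I_n -> bool)
    (y : 'I_m -> bool) : bool :=
  eval (pasg a b y) (hat F).

Lemma eq_evalhat (n m : nat) (F : form (fvar n m)) (a a' b b' : 'I_n -> bool)
    (y : 'I_m -> bool) :
  a =1 a' -> b =1 b' -> evalhat F a b y = evalhat F a' b' y.
Proof. by move=> ea eb; apply: eq_eval => -[k|k|j] /=. Qed.

Lemma evalhat_neg (n m : nat) (F : form (fvar n m)) (x : 'I_n -> bool)
    (y : 'I_m -> bool) :
  evalhat F x (fun k => ~~ x k) y = eval (asg x y) F.
Proof.
rewrite /evalhat; elim: F => [b|[k|j]|g IH|g IHg h IHh|g IHg h IHh] //=;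
  rewrite ?IHg ?IHh //.
by case: g IH => [b|[k|j]|g|g h|g h] //= ->.
Qed.

(** In NNF the only negations left in [hat F] are on inputs [Y j], and these have the same values on
    both sides. *)
Lemma evalhat_mono (n m : nat) (F : form (fvar n m)) (a a' b b' : 'I_n -> bool)
    (y : 'I_m -> bool) :
  is_nnf F -> (forall k, a k -> a' k) -> (forall k, b k -> b' k) ->
  evalhat F a b y -> evalhat F a' b' y.
Proof.
rewrite /evalhat => nnf la lb.
elim: F nnf => [c|[k|j]|g _|g IHg h IHh|g IHg h IHh] //=.
- by move=> _; apply: la.
- by case: g => // -[k|j] _ //=; apply: lb.
- by case/andP=> ng nh /andP[/(IHg ng)-> /(IHh nh)->].
- by case/andP=> ng nh /orP[/(IHg ng)-> | /(IHh nh)->] //; rewrite orbT.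
Qed.

(** Semantic counterpart of [reduct F i.+1] followed by [bar_neg]. The shift by one makes [k < i]
    the variables set to 1, so [i = 0] gives [F] itself. *)
Definition evalred (n m : nat) (F : form (fvar n m)) (i : nat)
    (x : 'I_n -> bool) (y : 'I_m -> bool) : bool :=
  evalhat F (fun k => (k < i) || x k) (fun k => (k < i) || ~~ x k) y.

Lemma eval_reduct (n m : nat) (F : form (fvar n m)) (i : nat)
    (x : 'I_n -> bool) (y : 'I_m -> bool) :
  eval (asg x y) (subst (@bar_neg n m) (reduct F i.+1)) = evalred F i x y.
Proof.
rewrite /reduct !eval_subst; apply: eq_eval => -[k|k|j] //=; by case: ifP.
Qed.

Definition evalalpha (n m : nat) (F : form (fvar n m)) (i : nat) (b c : bool)
    (x : 'I_n -> bool) (y : 'I_m -> bool) : bool :=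
  evalhat F (fun k => (k < i) || (if k == i :> nat then b else x k))
            (fun k => (k < i) || (if k == i :> nat then c else ~~ x k)) y.

Lemma eval_alpha (n m : nat) (F : form (fvar n m)) (i : nat) (b c : bool)
    (x : 'I_n -> bool) (y : 'I_m -> bool) :
  eval (asg x y) (alpha F i.+1 b c) = evalalpha F i b c x y.
Proof.
rewrite /alpha /reduct !eval_subst; apply: eq_eval => -[k|k|j] //=;
  by case: ifP => //= _; rewrite eqSS; case: eqP.
Qed.

(** Opposite constants for a variable and its bar amount to an ordinary Boolean value of that
    variable. *)
Lemma evalred_alpha (n m : nat) (F : form (fvar n m)) (i : nat) (b : bool)
    (x : 'I_n -> bool) (y : 'I_m -> bool) :
  evalalpha F i b (~~ b) x y =
  evalred F i (fun k => if k == i :> nat then b else x k) y.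
Proof. by apply: eq_evalhat => k; case: eqP. Qed.

Lemma evalred_alpha11 (n m : nat) (F : form (fvar n m)) (i : nat)
    (x : 'I_n -> bool) (y : 'I_m -> bool) :
  evalalpha F i true true x y = evalred F i.+1 x y.
Proof.
by apply: eq_evalhat => k; rewrite [k < i.+1]ltnS; case: ltngtP.
Qed.

(** Here alone unrealizability enters: [alpha] with both constants 1 is the next reduct, so one of
    the two mixed cases must hold. *)
Lemma evalred_split (n m : nat) (F : form (fvar n m)) (i : nat)
    (x : 'I_n -> bool) (y : 'I_m -> bool) :
  SynNNF F -> i < n -> evalred F i.+1 x y ->
  evalalpha F i true false x y || evalalpha F i false true x y.
Proof.
case=> _ /(_ i.+1) H lin; rewrite -evalred_alpha11 => e.
have /= := H lin (asg x y); rewrite !eval_alpha e /=.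
by case: evalalpha; case: evalalpha.
Qed.

Lemma eq_evalred (n m : nat) (F : form (fvar n m)) (i : nat)
    (x x' : 'I_n -> bool) (y : 'I_m -> bool) :
  (forall k : 'I_n, i <= k -> x k = x' k) -> evalred F i x y = evalred F i x' y.
Proof. by move=> e; apply: eq_evalhat => k; case: ltnP => //= /e ->. Qed.

Lemma evalred_of_eval (n m : nat) (F : form (fvar n m)) (i : nat)
    (x : 'I_n -> bool) (y : 'I_m -> bool) :
  is_nnf F -> eval (asg x y) F -> evalred F i x y.
Proof.
move=> nnf; rewrite -evalhat_neg; apply: evalhat_mono => // k ->;
  by rewrite orbT.
Qed.

Lemma evalred_ex_prefix (n m : nat) (F : form (fvar n m)) (i : nat)
    (x : 'I_n -> bool) (y : 'I_m -> bool) :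
  SynNNF F -> i <= n -> evalred F i x y -> ex_prefix F i x y.
Proof.
move=> synF; elim: i x => [|i IH] x lin.
  by move=> e; exists x; split=> //; rewrite -evalhat_neg.
(* Only coordinate [i] of [x] is overwritten by [b], so the inductive witness still agrees with [x]
   from [i.+1] on. *)
have step b : evalalpha F i b (~~ b) x y -> ex_prefix F i.+1 x y.
  rewrite evalred_alpha => /IH [|x' [ex' Fx']]; first exact: ltnW.
  by exists x'; split=> // k lik; rewrite ex' ?(ltnW lik) // gtn_eqF.
by move/(evalred_split synF lin)/orP => [/(step true)|/(step false)].
Qed.

Lemma ex_prefix_reduct (n m : nat) (F : form (fvar n m)) (i : nat)
    (x : 'I_n -> bool) (y : 'I_m -> bool) :
  SynNNF F -> i <= n ->
  ex_prefix F i x y <->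
  eval (asg x y) (subst (@bar_neg n m) (reduct F i.+1)).
Proof.
move=> synF lin; rewrite eval_reduct; split; last exact: evalred_ex_prefix.
case=> x' [ex' Fx']; rewrite -(eq_evalred F y ex').
by apply: evalred_of_eval => //; case: synF.
Qed.

(** The equations are triangular: [evalalpha F k] fixes the coordinates up to [k] by constants, so
    [psi k] reads only later components. Going down from [i = n], every reduct stays true at
    [psi]. *)
Lemma is_skolem_alpha10 (n m : nat) (F : form (fvar n m))
    (psi : 'I_n -> ('I_m -> bool) -> bool) :
  SynNNF F ->
  (forall k y, psi k y = evalalpha F k true false (psi^~ y) y) ->
  is_skolem F psi.
Proof.
move=> synF psiE y; split=> [[x Fx]|]; last by exists (psi^~ y).
suff H i : i <= n -> evalred F i (psi^~ y) y.
  by rewrite -evalhat_neg; apply: (H 0).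
(* Induction on the distance [n - i]. At [i = n] all coordinates are set to 1, so the given [x] can
   replace [psi]. *)
move=> lin; rewrite -(subKn lin); elim: (n - i) => [|d IH] {i lin}.
  rewrite subn0 (@eq_evalred _ _ _ _ _ x); last first.
    by move=> k; rewrite leqNgt ltn_ord.
  by apply: evalred_of_eval => //; case: synF.
case: (ltnP d n) => [ldn|led]; last first.
  by have -> : n - d.+1 = n - d by lia.
have i_lt : n - d.+1 < n by lia.
have eS : n - d = (n - d.+1).+1 by lia.
rewrite eS in IH; move: (evalred_split synF i_lt IH).
have step b : psi (Ordinal i_lt) y = b ->
    evalalpha F (n - d.+1) b (~~ b) (psi^~ y) y ->
    evalred F (n - d.+1) (psi^~ y) y.
  move=> psi_i; rewrite evalred_alpha => /(etrans _); apply.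
  apply: eq_evalred => k _; case: eqP => // ek.
  by rewrite -psi_i; congr psi; apply: val_inj.
(* If the case with constants 1, 0 holds, then [psi] is 1 there and this case is the reduct at
   [psi]; otherwise [psi] is 0 and the split leaves the case 0, 1. *)
have := psiE (Ordinal i_lt) y; rewrite /=.
case e: (evalalpha _ _ _ _ _ _) => psi_i /= h.
  exact: step psi_i e.
exact: step psi_i h.
Qed.

(** * The DAG of the Skolem functions *)

Lemma size_unfold_dag (V : Type) (D : seq (gate V)) :
  size (unfold_dag D) = size D.
Proof.
elim/last_ind: D => // D g; rewrite /unfold_dag -cats1 foldl_cat /=.
by rewrite !size_rcons size_cat addn1 => ->.
Qed.

Lemma wf_dag_nth (V : Type) (D : seq (gate V)) :
  wf_dag D <->
  forall k, k < size D ->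
    all (fun p => p < k) (children (nth (GConst false) D k)).
Proof.
split=> [wfD k lkD | wfD k g eg].
  apply: wfD; have := onthTE D k; rewrite lkD -(odflt_onth (GConst false)).
  by case: onth.
have lkD : k < size D by rewrite -onthTE eg.
by have := wfD k lkD; rewrite -odflt_onth eg.
Qed.

Lemma eq_gate_form (V : Type) (fs fs' : seq (form V)) (g : gate V) :
  {in children g, forall p, nth (FConst false) fs p = nth (FConst false) fs' p} ->
  gate_form fs g = gate_form fs' g.
Proof.
case: g => //= [p|p q|p q] e; by rewrite !e ?inE ?eqxx ?orbT.
Qed.

(** Unfolding only appends formulas, and the arguments of gate [k] lie below [k], so they can be
    looked up in the final list instead of the prefix available when the gate was read. *)
Lemma nth_unfold_dag (V : Type) (D : seq (gate V)) (k : nat) :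
  wf_dag D -> k < size D ->
  nth (FConst false) (unfold_dag D) k =
  gate_form (unfold_dag D) (nth (GConst false) D k).
Proof.
elim/last_ind: D => // D g IH /wf_dag_nth wfD; rewrite size_rcons => lk.
have unf : unfold_dag (rcons D g) =
    rcons (unfold_dag D) (gate_form (unfold_dag D) g).
  by rewrite /unfold_dag -cats1 foldl_cat.
have ext h p : p < size D -> nth h (unfold_dag D) p = nth h (unfold_dag (rcons D g)) p.
  by move=> lp; rewrite unf nth_rcons size_unfold_dag lp.
have := wfD k; rewrite size_rcons => /(_ lk) /allP ch.
have chD : forall p, p \in children (nth (GConst false) (rcons D g) k) ->
    nth (FConst false) (unfold_dag D) p =
    nth (FConst false) (unfold_dag (rcons D g)) p.
  by move=> p /ch lpk; apply: ext; lia.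
rewrite -(eq_gate_form chD) unf !nth_rcons size_unfold_dag.
case: ltngtP => [lkD|gkD|_ //]; last by lia.
apply: IH => //; apply/wf_dag_nth => q lq.
by have := wfD q; rewrite size_rcons nth_rcons lq; apply; lia.
Qed.

Section SkolemDag.

Variables (n m : nat) (D : seq (gate (fvar n m))).

(* The position of the root of the copy of [D] that computes psi_(k+1). *)
Definition out_pos (k : nat) : nat := (n - k) * size D - 1.

(* The copy of [D] for x_i: x_1, ..., x_i are 1, xbar_1, ..., xbar_(i-1) are 1,
   xbar_i is 0, and the later variables are read off the roots of the earlier
   copies.  The arguments of the copied gates are shifted by [b]. *)
Definition copy_gate (i b : nat) (g : gate (fvar n m)) : gate 'I_m :=
  match g with
  | GConst c => GConst c
  | GVar (X k) =>
      if i <= k then GAnd (out_pos k) (out_pos k) else GConst true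
  | GVar (Y j) => GVar j
  | GNot p =>
      if nth (GConst false) D p is GVar (X k) then
        if i <= k then GNot (out_pos k) else GConst (k.+1 != i)
      else GNot (b + p)
  | GAnd p q => GAnd (b + p) (b + q)
  | GOr p q => GOr (b + p) (b + q)
  end.

(** Copies are numbered from 0, and copy [t] serves x_(n-t): outputs are produced in decreasing
    order because each reads only later ones. *)
Fixpoint copies (t : nat) : seq (gate 'I_m) :=
  if t is t'.+1 then
    copies t' ++ map (copy_gate (n - t') (t' * size D)) D
  else [::].

Lemma size_copies (t : nat) : size (copies t) = t * size D.
Proof. by elim: t => // t IH; rewrite /= size_cat size_map IH; lia. Qed.

Lemma nth_copies (T t j : nat) : t < T -> j < size D ->
  nth (GConst false) (copies T) (t * size D + j) =
  copy_gate (n - t) (t * size D) (nth (GConst false) D j).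
Proof.
elim: T => // T IH ltT ljD; rewrite /= nth_cat size_copies.
case: (ltngtP t T) => [lt|gt|->]; first 1 last.
- by lia.
- rewrite ltnNge leq_addr /= addKn (nth_map (GConst false)) //.
rewrite ifT; first exact: IH.
apply: (@leq_trans (t.+1 * size D)); first by rewrite mulSn; lia.
by rewrite leq_mul2r lt orbT.
Qed.

Lemma copies_nth_ex (T p : nat) : p < T * size D ->
  exists t j, [/\ p = t * size D + j, t < T & j < size D].
Proof.
move=> lp; have D_gt0 : 0 < size D by case: (size D) lp => //; rewrite muln0.
exists (p %/ size D), (p %% size D).
by rewrite -divn_eq ltn_mod ltn_divLR.
Qed.

Hypothesis (D_gt0 : 0 < size D) (wfD : wf_dag D).

(** The root for [k] ends copy [n - k - 1], which precedes copy [t]; positivity of [size D] keeps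
    the subtraction of 1 from truncating. *)
Lemma out_pos_lt (k t : nat) : k < n -> n - t <= k -> out_pos k < t * size D.
Proof.
move=> lkn ltk; have : (n - k) * size D <= t * size D.
  by rewrite leq_mul2r; apply/orP; right; lia.
have : 0 < (n - k) * size D by rewrite muln_gt0 D_gt0; lia.
by rewrite /out_pos; lia.
Qed.

Lemma wf_copies : wf_dag (copies n).
Proof.
apply/wf_dag_nth => p; rewrite size_copies => /copies_nth_ex [t [j [-> lt lj]]].
rewrite nth_copies //; have /wf_dag_nth/(_ j lj) := wfD.
have out k : k < n -> n - t <= k -> out_pos k < t * size D + j.
  by move=> lk ltk; apply: ltn_addr; apply: out_pos_lt.
case: nth => [c|[k|i]|p'|p' q|p' q] //=; rewrite ?andbT ?ltn_add2l //.
  by case: leqP => [le|] //=; rewrite !out.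
move=> lp; case: nth => [c|[k|i]|p''|p'' q|p'' q] //=; rewrite ?andbT ?ltn_add2l //.
by case: leqP => [le|] //=; rewrite !out.
Qed.

(** Strong induction on the node inside one copy. Since [psi] is whatever the output nodes compute,
    no induction over the copies is needed. The right-hand side is the [alpha] with constants 1, 0
    at 0-based index [n - t.+1]. *)
Lemma eval_copy (y : 'I_m -> bool) (t j : nat)
    (psi : 'I_n -> bool) :
  t < n -> j < size D -> is_nnf (nth (FConst false) (unfold_dag D) j) ->
  (forall k, psi k = eval y (nth (FConst false) (unfold_dag (copies n)) (out_pos k))) ->
  eval y (nth (FConst false) (unfold_dag (copies n)) (t * size D + j)) =
  evalhat (nth (FConst false) (unfold_dag D) j)
    (fun k => (k <= n - t.+1) || psi k)
    (fun k => (k < n - t.+1) || (if k == n - t.+1 :> nat then false else ~~ psi k)) y.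
Proof.
move=> ltn ljD nnf psiE; elim/ltn_ind: j ljD nnf => j IH ljD.
have lt_copies : t * size D + j < size (copies n).
  rewrite size_copies; apply: (@leq_trans (t.+1 * size D)).
    by rewrite mulSn; lia.
  by rewrite leq_mul2r ltn orbT.
rewrite (nth_unfold_dag wf_copies lt_copies) nth_copies // (nth_unfold_dag wfD ljD).
have nSt : n - t = (n - t.+1).+1 by lia.
have /wf_dag_nth/(_ j ljD) := wfD.
case: (nth _ D j) => [c|[k|i]|p|p q|p q] //=; rewrite /evalhat /=.
(* A later variable is copied as the conjunction of an output node with itself, which acts as a wire
   and keeps one gate per gate of [D]. *)
- move=> _ _; rewrite nSt; case: ltnP => lek /=.
    by rewrite -psiE andbb.
  by [].
- rewrite andbT => lpj; have lpD : p < size D by apply: ltn_trans ljD.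
  have /= := IH p lpj lpD; rewrite /evalhat (nth_unfold_dag wfD lpD).
  (* NNF leaves only variables below a negation. For an input the induction hypothesis applies; for
     an [X k] the copied leaf is bypassed. *)
  case: (nth _ D p) => [c|[k|i]|p'|p' q|p' q] //=; last by move=> -> //.
  move=> _ _; rewrite nSt; case: ltnP => lek /=.
    by rewrite -psiE ltnNge (ltnW lek) gtn_eqF.
  by rewrite eqSS; case: ltngtP lek.
- case/and3P=> [lp lq _] /andP[np nq].
  by rewrite !IH ?(ltn_trans _ ljD).
- case/and3P=> [lp lq _] /andP[np nq].
  by rewrite !IH ?(ltn_trans _ ljD).
Qed.

(** The last node of each copy unfolds the root of [D], so [eval_copy] yields exactly the equations
    of [is_skolem_alpha10]. *)
Lemma is_skolem_copies (F : form (fvar n m)) (outs : seq nat) :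
  SynNNF F -> dag_of F D ->
  (forall k : 'I_n, nth 0 outs k = out_pos k) ->
  is_skolem F (dag_fun (copies n) outs).
Proof.
move=> synF [_ rootD] outsE; apply: is_skolem_alpha10 => // k y.
have ljD : (size D).-1 < size D by rewrite prednK.
have rootF : nth (FConst false) (unfold_dag D) (size D).-1 = F.
  by rewrite -odflt_onth rootD.
have lk : n - k.+1 < n by have := ltn_ord k; lia.
have := @eval_copy y _ _ (fun k => dag_fun (copies n) outs k y) lk ljD.
rewrite rootF => H.
have posE : (n - k.+1) * size D + (size D).-1 = out_pos k.
  rewrite /out_pos; have -> : n - k = (n - k.+1).+1 by have := ltn_ord k; lia.
  by rewrite mulSn addnC -subn1 addnBAC.
rewrite {1}/dag_fun outsE -posE H; first 1 last.
- by case: synF.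
- by move=> i; rewrite /dag_fun outsE.
have -> : n - (n - k.+1).+1 = k by have := ltn_ord k; lia.
by apply: eq_evalhat => i //; case: ltngtP.
Qed.

End SkolemDag.

(** * Running RAM programs *)

Section Exec.

Variables (P : seq instr) (W : nat).

(* From position [p], with registers [l] (0 beyond the end of [l]) and memory
   [M], the program reaches a configuration satisfying [Q] within [t] steps. *)
Definition exec (t p : nat) (l M : seq nat) (Q : config -> Prop) : Prop :=
  forall r, r =1 nth 0 l ->
  exists k c, [/\ k <= t, run P W k (Config p r M) = Some c & Q c].

Lemma exec_le (t t' p : nat) (l M : seq nat) (Q : config -> Prop) :
  t <= t' -> exec t p l M Q -> exec t' p l M Q.
Proof.
move=> le_t H r /H [k [c [le_k Hrun Qc]]]; exists k, c; split=> //.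
exact: leq_trans le_t.
Qed.

Lemma exec_done (t p : nat) (l M : seq nat) (Q : config -> Prop) :
  (forall r, r =1 nth 0 l -> Q (Config p r M)) -> exec t p l M Q.
Proof. by move=> H r /H Qc; exists 0, (Config p r M). Qed.

(** Register functions are matched with lists only pointwise, which avoids extensionality and lets
    the rules below execute symbolically on concrete lists. *)
Lemma exec_step (t p p' : nat) (l l' M M' : seq nat) (Q : config -> Prop) :
  (forall r, r =1 nth 0 l ->
     exists2 r', step P W (Config p r M) = Some (Config p' r' M')
               & r' =1 nth 0 l') ->
  exec t p' l' M' Q -> exec t.+1 p l M Q.
Proof.
move=> Hstep H r /Hstep [r' stepE /H [k [c [le_k runE Qc]]]].
by exists k.+1, c; rewrite /= stepE.
Qed.

Lemma exec_set_reg (t p r v : nat) (l M : seq nat) (Q : config -> Prop) :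
  v < W ->
  (forall s, s =1 nth 0 l ->
     step P W (Config p s M) = set_reg W (Config p s M) r v) ->
  exec t p.+1 (set_nth 0 l r v) M Q -> exec t.+1 p l M Q.
Proof.
move=> lv H; apply: exec_step => s es; rewrite H // /set_reg lv /=.
by eexists; first by []; move=> k; rewrite nth_set_nth /= es.
Qed.

Lemma exec_const (t p r v : nat) (l M : seq nat) (Q : config -> Prop) :
  onth P p = Some (IConst r v) -> v < W ->
  exec t p.+1 (set_nth 0 l r v) M Q -> exec t.+1 p l M Q.
Proof. by move=> e lv; apply: exec_set_reg => // s es; rewrite /step e. Qed.

Lemma exec_move (t p r a : nat) (l M : seq nat) (Q : config -> Prop) :
  onth P p = Some (IMove r a) -> nth 0 l a < W ->
  exec t p.+1 (set_nth 0 l r (nth 0 l a)) M Q -> exec t.+1 p l M Q.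
Proof. by move=> e lv; apply: exec_set_reg => // s es; rewrite /step e /= es. Qed.

Lemma exec_add (t p r a b : nat) (l M : seq nat) (Q : config -> Prop) :
  onth P p = Some (IAdd r a b) -> nth 0 l a + nth 0 l b < W ->
  exec t p.+1 (set_nth 0 l r (nth 0 l a + nth 0 l b)) M Q -> exec t.+1 p l M Q.
Proof. by move=> e lv; apply: exec_set_reg => // s es; rewrite /step e /= !es. Qed.

Lemma exec_sub (t p r a b : nat) (l M : seq nat) (Q : config -> Prop) :
  onth P p = Some (ISub r a b) -> nth 0 l a - nth 0 l b < W ->
  exec t p.+1 (set_nth 0 l r (nth 0 l a - nth 0 l b)) M Q -> exec t.+1 p l M Q.
Proof. by move=> e lv; apply: exec_set_reg => // s es; rewrite /step e /= !es. Qed.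

(** The loaded word [v] is a separate parameter, so that it can be named by its meaning rather than
    as a memory lookup. *)
Lemma exec_load (v t p r a : nat) (l M : seq nat) (Q : config -> Prop) :
  onth P p = Some (ILoad r a) -> nth 0 l a < size M ->
  nth 0 M (nth 0 l a) = v -> v < W ->
  exec t p.+1 (set_nth 0 l r v) M Q -> exec t.+1 p l M Q.
Proof.
move=> e la ev lv; apply: exec_set_reg => // s es; rewrite /step e /= es.
by move: la ev; rewrite -onthTE -(odflt_onth 0 M); case: onth => //= w _ ->.
Qed.

Lemma exec_store (t p a b : nat) (l M : seq nat) (Q : config -> Prop) :
  onth P p = Some (IStore a b) -> nth 0 l a < size M ->
  exec t p.+1 l (set_nth 0 M (nth 0 l a) (nth 0 l b)) Q -> exec t.+1 p l M Q.
Proof.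
move=> e la; apply: exec_step => s es; rewrite /step e /= !es la.
by exists s.
Qed.

Lemma exec_jump (t p q : nat) (l M : seq nat) (Q : config -> Prop) :
  onth P p = Some (IJump q) -> exec t q l M Q -> exec t.+1 p l M Q.
Proof. by move=> e; apply: exec_step => s es; rewrite /step e; exists s. Qed.

Lemma exec_jump_zero (t p a q : nat) (l M : seq nat) (Q : config -> Prop) :
  onth P p = Some (IJumpZ a q) -> nth 0 l a = 0 ->
  exec t q l M Q -> exec t.+1 p l M Q.
Proof.
move=> e a0; apply: exec_step => s es; rewrite /step e /= es a0.
by exists s.
Qed.

Lemma exec_jump_pos (t p a q : nat) (l M : seq nat) (Q : config -> Prop) :
  onth P p = Some (IJumpZ a q) -> 0 < nth 0 l a ->
  exec t p.+1 l M Q -> exec t.+1 p l M Q.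
Proof.
move=> e a0; apply: exec_step => s es; rewrite /step e /= es.
by rewrite eqn0Ngt a0; exists s.
Qed.

End Exec.

(** * The program *)

(* Registers: r0, r1, r2 are the output format; r3 = n; r4 = the number of
   nodes of the input; r5 = the index i of the current copy; r6 = the address
   read next; r7 = the number of nodes of the copy that remain; r8 = the address
   written next; r9 = the position of the first node of the copy; (r10, r11,
   r12) = the node being translated; r15 = 1; r16 = 3.  The [n] output positions
   are stored right after the input, followed by the output DAG. *)
Definition prog : seq instr :=
  [:: IConst 15 1; IConst 16 3; ILoad 3 13; IConst 13 2; ILoad 4 13;
      IAdd 2 16 4; IAdd 2 2 4; IAdd 2 2 4; IAdd 0 2 3; IMove 8 0; IMove 5 3;
  (* 11: next copy *)
      IJumpZ 5 87; IMove 6 16; IMove 7 4; IMove 9 1;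
  (* 15: next node *)
      IJumpZ 7 82; ILoad 10 6; IAdd 6 6 15; ILoad 11 6; IAdd 6 6 15;
      ILoad 12 6; IAdd 6 6 15; IJumpZ 10 73; ISub 10 10 15; IJumpZ 10 32;
      ISub 10 10 15; IJumpZ 10 45; IAdd 10 10 15; IAdd 10 10 15; IAdd 11 11 9;
      IAdd 12 12 9; IJump 73;
  (* 32: variable *)
      IJumpZ 11 35; IMove 10 15; IJump 73;
  (* 35: variable x_k *)
      ISub 13 5 12; IJumpZ 13 40; IMove 11 15; IConst 12 0; IJump 73;
  (* 40: x_k with k > i *)
      IAdd 13 2 12; ILoad 11 13; IMove 12 11; IMove 10 16; IJump 73;
  (* 45: negation *)
      IAdd 13 16 11; IAdd 13 13 11; IAdd 13 13 11; ILoad 14 13; IJumpZ 14 52;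
      ISub 14 14 15; IJumpZ 14 56;
  (* 52: negation of a node other than an x_k *)
      IConst 10 2; IAdd 11 11 9; IConst 12 0; IJump 73;
  (* 56: negated variable *)
      IAdd 13 13 15; ILoad 14 13; IJumpZ 14 60; IJump 52;
  (* 60: negated x_k *)
      IAdd 13 13 15; ILoad 12 13; ISub 13 5 12; IJumpZ 13 69; ISub 11 13 15;
      IConst 12 0; IJumpZ 11 73; IMove 11 15; IJump 73;
  (* 69: negated x_k with k > i *)
      IAdd 13 2 12; ILoad 11 13; IConst 12 0; IConst 10 2;
  (* 73: write the node *)
      IStore 8 10; IAdd 8 8 15; IStore 8 11; IAdd 8 8 15; IStore 8 12;
      IAdd 8 8 15; IAdd 1 1 15; ISub 7 7 15; IJump 15;
  (* 82: end of the copy *)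
      ISub 5 5 15; IAdd 13 2 5; ISub 14 1 15; IStore 13 14; IJump 11;
  (* 87: halt *)
      IHalt ].


(** * Words of an encoded DAG *)

Lemma nth_set_nth_if (T : Type) (x0 : T) (s : seq T) (p q : nat) (v : T) :
  nth x0 (set_nth x0 s p v) q = if q == p then v else nth x0 s q.
Proof. by rewrite nth_set_nth. Qed.

Lemma size_enc_gate (V : Type) (ev : V -> seq nat) (g : gate V) :
  (forall v, size (ev v) = 2) -> size (enc_gate ev g) = 3.
Proof. by move=> ev2; case: g => //= v; rewrite ev2. Qed.

Lemma size_enc_dag (V : Type) (ev : V -> seq nat) (D : seq (gate V)) :
  (forall v, size (ev v) = 2) -> size (enc_dag ev D) = 3 * size D.
Proof.
move=> ev2; elim: D => // g D IH; rewrite /enc_dag /= size_cat [size (flatten _)]IH.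
by rewrite size_enc_gate // mulnS.
Qed.

Lemma nth_enc_dag (V : Type) (ev : V -> seq nat) (D : seq (gate V)) (j w : nat) :
  (forall v, size (ev v) = 2) -> j < size D -> w < 3 ->
  nth 0 (enc_dag ev D) (3 * j + w) =
  nth 0 (enc_gate ev (nth (GConst false) D j)) w.
Proof.
move=> ev2; elim: D j => // g D IH j lj lw; rewrite /enc_dag /= nth_cat size_enc_gate //.
case: j lj => [|j] lj; first by rewrite muln0 lw.
by rewrite mulnS ltnNge -addnA leq_addr /= addKn IH.
Qed.

Lemma enc_dag_rcons (V : Type) (ev : V -> seq nat) (D : seq (gate V)) (g : gate V) :
  enc_dag ev (rcons D g) = enc_dag ev D ++ enc_gate ev g.
Proof. by rewrite /enc_dag map_rcons -cats1 flatten_cat /= cats0. Qed.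

Lemma enc_gate3 (V : Type) (ev : V -> seq nat) (g : gate V) :
  (forall v, size (ev v) = 2) ->
  let w := nth 0 (enc_gate ev g) in enc_gate ev g = [:: w 0; w 1; w 2].
Proof.
move=> ev2; case: g => //= v.
by case: (ev v) (ev2 v) => [|a [|b []]].
Qed.

(** * Correctness of the program by symbolic execution *)

Section Correctness.

Variables (n m : nat) (D : seq (gate (fvar n m))) (W S : nat).

Hypotheses (n_gt0 : 0 < n) (D_gt0 : 0 < size D) (wfD : wf_dag D).
(** The summands of [fitS] are the header, the input nodes, the output positions and the [n] copies.
    In [fitW], the term [m] accommodates input indices as words. *)
Hypotheses (fitS : 3 + 3 * size D + n + 3 * (n * size D) <= S) (fitW : S + m < W).

(** Loop invariant: [C] is the part of the output DAG already written, and the output positions from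
    [i] on are already stored. *)
Definition mem_ok (i : nat) (C : seq (gate 'I_m)) (M : seq nat) : Prop :=
  [/\ size M = S,
      forall a, a < 3 + 3 * size D -> nth 0 M a = nth 0 (enc_problem D) a,
      forall k, i <= k -> k < n -> nth 0 M (3 + 3 * size D + k) = out_pos D k
    & forall a, a < 3 * size C ->
        nth 0 M (3 + 3 * size D + n + a) = nth 0 (enc_dag (@enc_input_var m) C) a].

Lemma mem_ok_input (i j w : nat) (C : seq (gate 'I_m)) (M : seq nat) :
  mem_ok i C M -> j < size D -> w < 3 ->
  nth 0 M (3 + (3 * j + w)) =
  nth 0 (enc_gate (@enc_fvar n m) (nth (GConst false) D j)) w.
Proof.
move=> [_ inM _ _] lj lw; rewrite inM; last by lia.
by rewrite /enc_problem nth_cat ltnNge leq_addr /= addKn nth_enc_dag // => -[].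
Qed.

(** The three words land just past the encoding of [C], hence beyond the input and the output
    positions. *)
Lemma mem_ok_rcons (i : nat) (C : seq (gate 'I_m)) (g : gate 'I_m)
    (M : seq nat) (r8 : nat) :
  mem_ok i C M -> size C < n * size D ->
  r8 = 3 + 3 * size D + n + 3 * size C ->
  let w := nth 0 (enc_gate (@enc_input_var m) g) in
  mem_ok i (rcons C g)
    (set_nth 0 (set_nth 0 (set_nth 0 M r8 (w 0)) (r8 + 1) (w 1)) (r8 + 1 + 1) (w 2)).
Proof.
move=> [sM inM outM dagM] lC -> w; split.
- by rewrite !size_set_nth sM; lia.
- move=> a la; rewrite -inM // !nth_set_nth_if !ifF //; lia.
- move=> k lik lkn; rewrite -outM // !nth_set_nth_if !ifF //; lia.
move=> a; rewrite size_rcons => la.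
rewrite enc_dag_rcons (enc_gate3 g) // -/w nth_cat size_enc_dag //.
case: ltnP => [laC|leC].
  by rewrite -dagM // !nth_set_nth_if !ifF //; lia.
have [d ea] : exists d, a = 3 * size C + d.
  by exists (a - 3 * size C); rewrite subnKC.
have : d < 3 by lia.
rewrite ea addKn {a la leC ea}; case: d => [|[|[|//]]] _; rewrite !nth_set_nth_if.
- by do 2 (rewrite ifF; last by lia); rewrite ifT //; lia.
- by rewrite ifF; [rewrite ifT //; lia | lia].
- by rewrite ifT //; lia.
Qed.

Lemma out_pos_le (k : nat) : out_pos D k <= n * size D.
Proof.
apply: leq_trans (leq_subr _ _) _.
by rewrite leq_mul2r leq_subr orbT.
Qed.

(** The nine-instruction tail shared by all kinds of nodes. *)
Lemma exec_emit (g : gate 'I_m) (C : seq (gate 'I_m)) (t i r6 r7 r8 r9 r13 r14 : nat)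
    (M : seq nat) (Q : config -> Prop) :
  let w := nth 0 (enc_gate (@enc_input_var m) g) in
  mem_ok i C M -> size C < n * size D ->
  r8 = 3 + 3 * size D + n + 3 * size C -> r7 < W ->
  (forall M', mem_ok i (rcons C g) M' ->
     exec prog W t 15
       [:: 3 + 3 * size D + n; size C + 1; 3 + 3 * size D; n; size D; i; r6;
           r7 - 1; r8 + 1 + 1 + 1; r9; w 0; w 1; w 2; r13; r14; 1; 3] M' Q) ->
  exec prog W t.+4.+4.+1 73
    [:: 3 + 3 * size D + n; size C; 3 + 3 * size D; n; size D; i; r6;
        r7; r8; r9; w 0; w 1; w 2; r13; r14; 1; 3] M Q.
Proof.
move=> w okM lC er8 lr7 H.
have sM : size M = S by case: okM.
apply: exec_store => //=; first by lia.
apply: exec_add => //=; first by lia.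
apply: exec_store => //=; first by rewrite size_set_nth; lia.
apply: exec_add => //=; first by lia.
apply: exec_store => //=; first by rewrite !size_set_nth; lia.
apply: exec_add => //=; first by lia.
apply: exec_add => //=; first by lia.
apply: exec_sub => //=; first by lia.
apply: exec_jump => //=.
by apply: H; apply: mem_ok_rcons.
Qed.

(** One pass of the inner loop, by cases on the node read; 45 is a uniform bound on the steps of all
    branches. *)
Lemma exec_node (t i j r6 r7 r8 r9 r10 r11 r12 r13 r14 : nat)
    (C : seq (gate 'I_m)) (M : seq nat) (Q : config -> Prop) :
  mem_ok i C M -> size C < n * size D -> j < size D -> i <= n ->
  r9 <= n * size D -> r6 = 3 + 3 * j -> r7 = size D - j ->
  r8 = 3 + 3 * size D + n + 3 * size C ->
  (forall M' s6 s7 s8 s10 s11 s12 s13 s14,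
     mem_ok i (rcons C (copy_gate D i r9 (nth (GConst false) D j))) M' ->
     s6 = 3 + 3 * j.+1 -> s7 = size D - j.+1 ->
     s8 = 3 + 3 * size D + n + 3 * (size C + 1) ->
     exec prog W t 15
       [:: 3 + 3 * size D + n; size C + 1; 3 + 3 * size D; n; size D; i;
           s6; s7; s8; r9; s10; s11; s12; s13; s14; 1; 3] M' Q) ->
  exec prog W (45 + t) 15
    [:: 3 + 3 * size D + n; size C; 3 + 3 * size D; n; size D; i;
        r6; r7; r8; r9; r10; r11; r12; r13; r14; 1; 3] M Q.
Proof.
move=> okM lC ljD lin lr9 er6 er7 er8 H.
have sM : size M = S by case: okM.
have w0 := mem_ok_input okM ljD (isT : 0 < 3).
have w1 := mem_ok_input okM ljD (isT : 1 < 3).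
have w2 := mem_ok_input okM ljD (isT : 2 < 3).
(* [lia] treats the product as an atom, so its linear bounds are supplied. *)
have D_le : size D <= n * size D by rewrite leq_pmull.
have n_le : n <= n * size D by rewrite leq_pmulr.
have /wf_dag_nth/(_ j ljD) := wfD.
move: H w0 w1 w2; set g := nth _ D j => H.
set e := enc_gate _ g => w0 w1 w2 wfg.
have [e0 e1 e2] : [/\ nth 0 e 0 <= 4, nth 0 e 1 < W & nth 0 e 2 < W].
  rewrite /e; case: (g) wfg => [[]|[k|k]|p|p q|p q] /=; split => //;
    try have := ltn_ord k; lia.
(* Every branch ends here, with the words of the copied gate in registers 10 to 12; [t'] absorbs the
   steps left over. *)
have emit g' s6 s7 s10 s11 s12 s13 s14 t' :
    g' = copy_gate D i r9 g ->
    [:: s10; s11; s12] = enc_gate (@enc_input_var m) g' ->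
    s6 = 3 + 3 * j.+1 -> t.+4.+4.+1 <= t' -> s7 = size D - j ->
    exec prog W t' 73
      [:: 3 + 3 * size D + n; size C; 3 + 3 * size D; n; size D; i;
          s6; s7; r8; r9; s10; s11; s12; s13; s14; 1; 3] M Q.
  move=> eg' ew es6 le_t es7; apply: exec_le le_t _.
  have [-> -> ->] : [/\ s10 = nth 0 (enc_gate (@enc_input_var m) g') 0,
      s11 = nth 0 (enc_gate (@enc_input_var m) g') 1 &
      s12 = nth 0 (enc_gate (@enc_input_var m) g') 2] by rewrite -ew.
  apply: (exec_emit okM) => // [|M' okM']; first by lia.
  by apply: H; rewrite -?eg' //; lia.
apply: exec_jump_pos => //=; first by lia.
apply: (@exec_load _ _ (nth 0 e 0)) => //=; try lia.
  by rewrite -w0; congr nth; lia.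
apply: exec_add => //=; first by lia.
apply: (@exec_load _ _ (nth 0 e 1)) => //=; try lia.
  by rewrite -w1; congr nth; lia.
apply: exec_add => //=; first by lia.
apply: (@exec_load _ _ (nth 0 e 2)) => //=; try lia.
  by rewrite -w2; congr nth; lia.
apply: exec_add => //=; first by lia.
rewrite /e {w0 w1 w2 e0 e1 e2 e}.
case eg: g wfg emit => [c|[k|k]|p|p q|p q] /= wfg emit.
- apply: exec_jump_zero => //=.
  by apply: emit; first (by []); by [|lia].
- have lk := ltn_ord k; apply: exec_jump_pos => //=.
  apply: exec_sub => //=; first by lia.
  apply: exec_jump_zero => //=.
  apply: exec_jump_zero => //=.
  (* Truncated subtraction [i - k] is zero exactly when [i <= k]. *)
  apply: exec_sub => //=; first by lia.
  case: (leqP i k) emit => [lik|lki] emit.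
    apply: exec_jump_zero => //=; first by lia.
    apply: exec_add => //=; first by lia.
    apply: (@exec_load _ _ (out_pos D k)) => //=; try lia.
    - by case: okM => _ _ -> .
    - by have := out_pos_le k; lia.
    apply: exec_move => //=; first by have := out_pos_le k; lia.
    apply: exec_move => //=; first by lia.
    apply: exec_jump => //=.
    by apply: emit; first (by []); by [|lia].
  (* Register 10, decremented during dispatch, already holds 0, the tag of a constant. *)
  apply: exec_jump_pos => //=; first by lia.
  apply: exec_move => //=; first by lia.
  apply: exec_const => //=; first by lia.
  apply: exec_jump => //=.
  by apply: emit; first (by []); by [|lia].
- have lk := ltn_ord k; apply: exec_jump_pos => //=.
  apply: exec_sub => //=; first by lia.
  apply: exec_jump_zero => //=.
  apply: exec_jump_pos => //=.
  apply: exec_move => //=; first by lia.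
  apply: exec_jump => //=.
  by apply: emit; first (by []); by [|lia].
- have lpj : p < j by case/andP: wfg.
  have lpD : p < size D by lia.
  have w0 := mem_ok_input okM lpD (isT : 0 < 3).
  have w1 := mem_ok_input okM lpD (isT : 1 < 3).
  have w2 := mem_ok_input okM lpD (isT : 2 < 3).
  apply: exec_jump_pos => //=.
  apply: exec_sub => //=; first by lia.
  apply: exec_jump_pos => //=.
  apply: exec_sub => //=; first by lia.
  apply: exec_jump_zero => //=.
  do 3 (apply: exec_add => //=; first by lia).
  set h := nth (GConst false) D p in emit w0 w1 w2.
  set e := enc_gate _ h in w0 w1 w2.
  have le4 : nth 0 e 0 <= 4 by rewrite /e; case: (h).
  apply: (@exec_load _ _ (nth 0 e 0)) => //=; try lia.
    by rewrite -w0; congr nth; lia.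
  (* The code for a negated node other than an [X k], reached from several branches: four
     instructions, then the nine of the tail. *)
  have plain s13 s14 t' : (if h is GVar (X _) then false else true) ->
      t.+4.+4.+4.+1 <= t' ->
      exec prog W t' 52
        [:: 3 + 3 * size D + n; size C; 3 + 3 * size D; n; size D; i;
          r6 + 1 + 1 + 1; r7; r8; r9; 2 - 1 - 1; p; 0; s13; s14; 1; 3] M Q.
    move=> hX le_t; apply: exec_le le_t _.
    apply: exec_const => //=; first by lia.
    apply: exec_add => //=; first by lia.
    apply: exec_const => //=; first by lia.
    apply: exec_jump => //=.
    by case: (h) emit hX => [?|[?|?]|?|??|??] // emit _;
      apply: emit; rewrite 1?addnC //; lia.
  rewrite {le4}/e in w0 w1 w2 *.
  case: h emit plain w0 w1 w2 => [c|[k|k]|p'|p' q|p' q] /= emit plain w0 w1 w2.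
  + by apply: exec_jump_zero => //=; apply: plain => //; lia.
  + have lk := ltn_ord k; apply: exec_jump_pos => //=.
    apply: exec_sub => //=; first by lia.
    apply: exec_jump_zero => //=.
    apply: exec_add => //=; first by lia.
    apply: (@exec_load _ _ 0) => //=; try lia.
      by rewrite -[RHS]w1; congr nth; lia.
    apply: exec_jump_zero => //=.
    apply: exec_add => //=; first by lia.
    apply: (@exec_load _ _ k) => //=; try lia.
      by rewrite -[RHS]w2; congr nth; lia.
    apply: exec_sub => //=; first by lia.
    case: (leqP i k) emit => [lik|lki] emit.
      apply: exec_jump_zero => //=; first by lia.
      apply: exec_add => //=; first by lia.
      apply: (@exec_load _ _ (out_pos D k)) => //=; try lia.
      - by case: okM => _ _ ->.
      - by have := out_pos_le k; lia.
      apply: exec_const => //=; first by lia.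
      apply: exec_const => //=; first by lia.
      by apply: emit; first (by []); by [|lia].
    apply: exec_jump_pos => //=; first by lia.
    apply: exec_sub => //=; first by lia.
    apply: exec_const => //=; first by lia.
    (* Register 11 holds [i - k - 1]; normalizing a nonzero value to 1 gives the constant
       [k.+1 != i]. *)
    case: (eqVneq k.+1 i) emit => [eki|neki] emit.
      apply: exec_jump_zero => //=; first by lia.
      by apply: emit; first (by []); rewrite -?eki ?subSnn //; lia.
    apply: exec_jump_pos => //=; first by lia.
    apply: exec_move => //=; first by lia.
    apply: exec_jump => //=.
    by apply: emit; first (by []); by [|lia].
  + have lk := ltn_ord k; apply: exec_jump_pos => //=.
    apply: exec_sub => //=; first by lia.
    apply: exec_jump_zero => //=.
    apply: exec_add => //=; first by lia.
    apply: (@exec_load _ _ 1) => //=; try lia.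
      by rewrite -[RHS]w1; congr nth; lia.
    apply: exec_jump_pos => //=.
    apply: exec_jump => //=.
    by apply: plain => //; lia.
  + apply: exec_jump_pos => //=; apply: exec_sub => //=; first by lia.
    by apply: exec_jump_pos => //=; apply: plain => //; lia.
  + apply: exec_jump_pos => //=; apply: exec_sub => //=; first by lia.
    by apply: exec_jump_pos => //=; apply: plain => //; lia.
  + apply: exec_jump_pos => //=; apply: exec_sub => //=; first by lia.
    by apply: exec_jump_pos => //=; apply: plain => //; lia.
- case/and3P: wfg => lp lq _.
  do 2 (apply: exec_jump_pos => //=; apply: exec_sub => //=; first by lia).
  apply: exec_jump_pos => //=.
  do 4 (apply: exec_add => //=; first by lia).
  apply: exec_jump => //=.
  by apply: emit; first (by []); rewrite /= 1?[_ + r9]addnC 1?[q + r9]addnC //; lia.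
- case/and3P: wfg => lp lq _.
  do 2 (apply: exec_jump_pos => //=; apply: exec_sub => //=; first by lia).
  apply: exec_jump_pos => //=.
  do 4 (apply: exec_add => //=; first by lia).
  apply: exec_jump => //=.
  by apply: emit; first (by []); rewrite /= 1?[_ + r9]addnC 1?[q + r9]addnC //; lia.
Qed.

(** Inner loop, by induction on the number [d] of nodes left; [take j D] is the part already copied,
    and the extra step is the exit test. *)
Lemma exec_nodes (T t d j r6 r7 r8 r9 r10 r11 r12 r13 r14 : nat) (M : seq nat)
    (Q : config -> Prop) :
  let C := copies D t ++ map (copy_gate D (n - t) (t * size D)) (take j D) in
  mem_ok (n - t) C M -> t < n -> j + d = size D ->
  r6 = 3 + 3 * j -> r7 = d -> r8 = 3 + 3 * size D + n + 3 * size C ->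
  r9 = t * size D ->
  (forall M' s6 s7 s8 s10 s11 s12 s13 s14,
     mem_ok (n - t) (copies D t.+1) M' ->
     s8 = 3 + 3 * size D + n + 3 * (t.+1 * size D) ->
     exec prog W T 82
       [:: 3 + 3 * size D + n; t.+1 * size D; 3 + 3 * size D; n; size D; n - t;
           s6; s7; s8; r9; s10; s11; s12; s13; s14; 1; 3] M' Q) ->
  exec prog W (45 * d + T.+1) 15
    [:: 3 + 3 * size D + n; size C; 3 + 3 * size D; n; size D; n - t;
        r6; r7; r8; r9; r10; r11; r12; r13; r14; 1; 3] M Q.
Proof.
elim: d j r6 r7 r8 r10 r11 r12 r13 r14 M
    => [|d IH] j r6 r7 r8 r10 r11 r12 r13 r14 M C okM lt ej er6 er7 er8 er9 H.
  have eC : C = copies D t.+1 by rewrite /C take_oversize //; lia.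
  apply: exec_jump_zero => //=.
  rewrite eC in okM er8 *; rewrite size_copies in er8 *.
  exact: H.
have ljD : j < size D by lia.
have sC : size C = t * size D + j.
  by rewrite /C size_cat size_copies size_map size_take ljD.
have le_t : t.+1 * size D <= n * size D by rewrite leq_mul2r lt orbT.
have -> : 45 * d.+1 + T.+1 = 45 + (45 * d + T.+1) by lia.
rewrite mulSn in le_t.
apply: (exec_node (j := j) okM) => //; try lia.
move=> M' s6 s7 s8 s10 s11 s12 s13 s14 okM' es6 es7 es8.
have eC : rcons C (copy_gate D (n - t) r9 (nth (GConst false) D j)) =
    copies D t ++ map (copy_gate D (n - t) (t * size D)) (take j.+1 D).
  by rewrite (take_nth (GConst false)) // map_rcons -rcons_cat er9.
have eS := size_rcons C (copy_gate D (n - t) r9 (nth (GConst false) D j)).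
rewrite eC in okM' eS; rewrite addn1 -eS in es8 *.
by apply: IH okM' lt _ es6 _ es8 er9 H; lia.
Qed.

(** The last node written is the root of copy [t], that is, the output for [k = n - t.+1]. *)
Lemma mem_ok_out (t : nat) (M : seq nat) :
  mem_ok (n - t) (copies D t.+1) M -> t < n ->
  mem_ok (n - t.+1) (copies D t.+1)
    (set_nth 0 M (3 + 3 * size D + (n - t.+1)) (t.+1 * size D - 1)).
Proof.
move=> [sM inM outM dagM] lt; split.
- by rewrite size_set_nth sM; lia.
- by move=> a la; rewrite -inM // nth_set_nth_if ifF //; lia.
- move=> k lk lkn; rewrite nth_set_nth_if; case: eqP => [ek|nek].
    by rewrite /out_pos; congr (_ * _ - _); lia.
  by apply: outM => //; lia.
by move=> a la; rewrite -dagM // nth_set_nth_if ifF //; lia.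
Qed.

(** Outer loop: besides its nodes, each copy costs ten steps, four to enter, one to leave the inner
    loop and five to store the output position. The final 1 is the exit test. *)
Lemma exec_copies (d t r6 r7 r8 r9 r10 r11 r12 r13 r14 : nat) (M : seq nat)
    (Q : config -> Prop) :
  mem_ok (n - t) (copies D t) M -> t + d = n ->
  r8 = 3 + 3 * size D + n + 3 * (t * size D) ->
  (forall r M', mem_ok 0 (copies D n) M' -> r 0 = 3 + 3 * size D + n ->
     r 1 = n * size D -> r 2 = 3 + 3 * size D -> Q (Config 87 r M')) ->
  exec prog W (d * (45 * size D + 10) + 1) 11
    [:: 3 + 3 * size D + n; t * size D; 3 + 3 * size D; n; size D; n - t;
        r6; r7; r8; r9; r10; r11; r12; r13; r14; 1; 3] M Q.
Proof.
elim: d t r6 r7 r8 r9 r10 r11 r12 r13 r14 M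
    => [|d IH] t r6 r7 r8 r9 r10 r11 r12 r13 r14 M okM etd er8 H.
  have etn : t = n by lia.
  rewrite etn subnn in okM *; apply: exec_jump_zero => //=.
  by apply: exec_done => r er; apply: H; rewrite ?er.
have lt : t < n by lia.
have le_t : t.+1 * size D <= n * size D by rewrite leq_mul2r lt orbT.
have le_t' : t * size D <= t.+1 * size D by rewrite leq_mul2r leqnSn orbT.
have -> : d.+1 * (45 * size D + 10) + 1 =
    (45 * size D + (d * (45 * size D + 10) + 1).+4.+1.+1).+4 by rewrite mulSn; lia.
apply: exec_jump_pos => //=; first by lia.
do 3 (apply: exec_move => //=; first by lia).
have eC : copies D t = copies D t ++
    map (copy_gate D (n - t) (t * size D)) (take 0 D) by rewrite take0 cats0.
rewrite -{1}(size_copies D t) eC.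
apply: exec_nodes => //; rewrite -?eC ?size_copies //.
move=> M' s6 s7 s8 s10 s11 s12 s13 s14 okM' es8.
have sM' : size M' = S by case: okM'.
apply: exec_sub => //=; first by lia.
apply: exec_add => //=; first by lia.
apply: exec_sub => //=; first by lia.
apply: exec_store => //=; first by lia.
apply: exec_jump => //=.
have okM'' := mem_ok_out okM' lt.
have -> : n - t - 1 = n - t.+1 by lia.
by apply: IH => //; lia.
Qed.

(** Eleven initializing instructions precede the outer loop; the list covers registers 0 to 16. *)
Lemma exec_prog (M : seq nat) (Q : config -> Prop) :
  M = enc_problem D ++ nseq (S - size (enc_problem D)) 0 ->
  (forall r M', mem_ok 0 (copies D n) M' -> r 0 = 3 + 3 * size D + n ->
     r 1 = n * size D -> r 2 = 3 + 3 * size D -> Q (Config 87 r M')) ->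
  exec prog W (n * (45 * size D + 10) + 12) 0 (nseq 17 0) M Q.
Proof.
move=> eM H.
have size_inp : size (enc_problem D) = 3 + 3 * size D.
  by rewrite /enc_problem size_cat size_enc_dag // => -[].
have okM : mem_ok (n - 0) (copies D 0) M.
  split=> //.
  - by rewrite eM size_cat size_nseq size_inp; lia.
  - by move=> a la; rewrite eM nth_cat size_inp la.
  - by move=> k; rewrite subn0; lia.
have sM : size M = S by case: okM.
have -> : n * (45 * size D + 10) + 12 =
    (n * (45 * size D + 10) + 1).+4.+4.+3 by lia.
apply: exec_const => //=; first by lia.
apply: exec_const => //=; first by lia.
apply: (@exec_load _ _ n) => //=; try lia.
  by rewrite eM.
apply: exec_const => //=; first by lia.
apply: (@exec_load _ _ (size D)) => //=; try lia.
  by rewrite eM.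
do 4 (apply: exec_add => //=; first by lia).
do 2 (apply: exec_move => //=; first by lia).
have -> : 3 + size D + size D + size D = 3 + 3 * size D by lia.
have := @exec_copies n 0 0 0 (3 + 3 * size D + n) 0 0 0 0 2 0 M Q okM.
by rewrite subn0 mul0n; apply => //; lia.
Qed.

End Correctness.

(** * Resource bounds and the final statement *)

(** With [a = n + m + N >= 2], the left side is at most [81 * a ^ 2], which is below
    [2 ^ 7 * a ^ 2 <= a ^ 9]. The exponent is 80 because one constant serves words, time and
    space. *)
Lemma word_fit (n m N : nat) : 0 < n -> 0 < N ->
  80 * (n * N) + m < (n + m + N) ^ 80.
Proof.
move=> n_gt0 N_gt0.
have [a_ge2 n_le N_le m_le] :
    [/\ 2 <= n + m + N, n <= n + m + N, N <= n + m + N & m <= n + m + N].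
  by split; lia.
move: (n + m + N) a_ge2 n_le N_le m_le => a a_ge2 n_le N_le m_le.
have nN_le : n * N <= a * a by rewrite leq_mul.
have a_le : a <= a * a by rewrite leq_pmulr //; lia.
have a_gt : 128 * (a * a) <= a ^ 80.
  apply: (@leq_trans (a ^ (7 + 2))); last by rewrite leq_pexp2l //; lia.
  by rewrite expnD mulnn leq_mul2r -[128]/(2 ^ 7) leq_exp2r // a_ge2 orbT.
by apply: leq_trans a_gt; lia.
Qed.

Lemma computes_skolem (n m : nat) (F : form (fvar n m))
    (D : seq (gate (fvar n m))) :
  0 < n -> SynNNF F -> dag_of F D ->
  computes prog ((n + m + size D) ^ 80) (80 * (n ^ 2 * size D))
    (80 * (n * size D)) (enc_problem D) (outputs_skolem F).
Proof.
move=> n_gt0 synF dagF; have [wfD rootD] := dagF.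
have D_gt0 : 0 < size D by case: (D) rootD.
have D_le : size D <= n * size D by rewrite leq_pmull.
have n_le : n <= n * size D by rewrite leq_pmulr.
(* The power is made opaque; only its lower bound matters from here on. *)
have := word_fit m n_gt0 D_gt0; move: (_ ^ 80) => W.
set S := 80 * (n * size D) => fitW.
have fitS : 3 + 3 * size D + n + 3 * (n * size D) <= S by rewrite /S; lia.
have size_inp : size (enc_problem D) = 3 + 3 * size D.
  by rewrite /enc_problem size_cat size_enc_dag // => -[].
have inpW : all (fun w => w < W) (enc_problem D).
  rewrite /enc_problem all_cat /= andbT; apply/andP.
  split; first by apply/and3P; split; lia.
  apply/(all_nthP 0) => a; rewrite size_enc_dag; last by case.
  (* Word [a] is word [a %% 3] of node [a %/ 3]. *)
  move=> la; rewrite (divn_eq a 3) mulnC nth_enc_dag ?ltn_mod //; first 1 last.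
  - by case.
  - by rewrite ltn_divLR // mulnC.
  set j := a %/ 3; have lj : j < size D by rewrite ltn_divLR // mulnC.
  have : a %% 3 < 3 by rewrite ltn_mod.
  have /wf_dag_nth/(_ j lj) := wfD.
  case: nth => [c|[k|k]|p|p q|p q] /= wfg; case: (a %% 3) => [|[|[|//]]] _ /=;
    try have := ltn_ord k; try case: c; lia.
have post r M : mem_ok D S 0 (copies D n) M -> r 0 = 3 + 3 * size D + n ->
    r 1 = n * size D -> r 2 = 3 + 3 * size D -> outputs_skolem F (Config 87 r M).
  move=> [sM _ outM dagM] r0 r1 r2.
  exists (copies D n), (slice (3 + 3 * size D) n M).
  have s_outs : size (slice (3 + 3 * size D) n M) = n.
    by rewrite size_takel // size_drop sM; lia.
  have outsE k : k < n -> nth 0 (slice (3 + 3 * size D) n M) k = out_pos D k.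
    by move=> lk; rewrite nth_take // nth_drop outM.
  split.
  - split; rewrite /= ?r0 ?r1 ?r2 ?size_copies //.
    have s_dag : size (slice (3 + 3 * size D + n) (3 * (n * size D)) M) =
        3 * (n * size D) by rewrite size_takel // size_drop sM; lia.
    apply: (@eq_from_nth _ 0); first by rewrite s_dag size_enc_dag // size_copies.
    by move=> a; rewrite s_dag => la; rewrite nth_take // nth_drop dagM // size_copies.
  - exact: wf_copies.
  - apply/(all_nthP 0) => k; rewrite s_outs => lk.
    by rewrite outsE // size_copies; apply: out_pos_lt => //; lia.
  - by apply: is_skolem_copies => // k; apply: outsE.
have := @exec_prog n m D W S n_gt0 D_gt0 wfD fitS fitW _
  (fun c => onth prog (pc c) = Some IHalt /\ outputs_skolem F c) (erefl _) _ (fun=> 0).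
case=> [r M okM r0 r1 r2 | k | k [c [le_k runE [haltE skE]]]].
- by split=> //; apply: post.
- by rewrite nth_nseq if_same.
split=> //; first by lia.
exists k, c; split=> //; apply: leq_trans le_k _.
(* The run is linear in [n * size D]; the quadratic bound follows from [0 < n]. *)
have : n * size D <= n ^ 2 * size D.
  by rewrite leq_mul2r -mulnn leq_pmulr ?orbT.
have -> : n * (45 * size D + 10) = 45 * (n * size D) + 10 * n by lia.
by lia.
Qed.

Theorem theorem1 :
  (forall (n m : nat) (F : form (fvar n m)), SynNNF F ->
     forall i : nat, 1 <= i <= n ->
     forall (x : 'I_n -> bool) (y : 'I_m -> bool),
       ex_prefix F i x y <->
       eval (asg x y) (subst (@bar_neg n m) (reduct F i.+1)))
  /\
  (exists (P : seq instr) (c : nat),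
     forall (n m : nat) (F : form (fvar n m)) (D : seq (gate (fvar n m))),
       0 < n -> SynNNF F -> dag_of F D ->
       computes P ((n + m + size D) ^ c)
         (c * (n ^ 2 * size D)) (c * (n * size D))
         (enc_problem D) (outputs_skolem F)).
Proof.
split=> [n m F synF i /andP[_ lin] x y|]; first exact: ex_prefix_reduct.
by exists prog, 80 => n m F D; apply: computes_skolem.
Qed.
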